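(* Let $p$ be an odd prime, and let $G$ be the Minač–Tân pro-$p$ group, i.e., the pro-$p$ group with pro-$p$ presentation $$G=\langle\,x_1,\ldots,x_5\ \mid\ [[x_1,x_2],x_3][x_4,x_5]=1\,\rangle.$$ Then there is no orientation $\theta\colon G\to1+p\mathbb{Z}_p$ such that the oriented pro-$p$ group $(G,\theta)$ is 1-cyclotomic.
   Context: Commutators are $[h,g]=h^{-1}g^{-1}hg$. Presentations of pro-$p$ groups are meant in the topological sense, and subgroups are closed. $1+p\mathbb{Z}_p=\{1+p\lambda\mid\lambda\in\mathbb{Z}_p\}$ is the (multiplicative) group of principal units of $\mathbb{Z}_p$. An oriented pro-$p$ group is a pair $(G,\theta)$ with $G$ a pro-$p$ group and $\theta\colon G\to 1+p\mathbb{Z}_p$ a continuous homomorphism, called an orientation. $\mathbb{Z}_p(\theta)$ denotes the continuous $G$-module equal to $\mathbb{Z}_p$ as an abelian pro-$p$ group, with action $g\cdot\lambda=\theta(g)\lambda$. $(G,\theta)$ is Kummerian if for every $n\geq1$ the natural map $\mathrm{H}^1(G,\mathbb{Z}_p(\theta)/p^n\mathbb{Z}_p(\theta))\to\mathrm{H}^1(G,\mathbb{Z}/p\mathbb{Z})$ induced by the epimorphism of $G$-modules $\mathbb{Z}_p(\theta)/p^n\mathbb{Z}_p(\theta)\to\mathbb{Z}/p$ (with $\mathbb{Z}/p$ a trivial module) is surjective. $(G,\theta)$ is 1-cyclotomic if $(H,\theta|_H)$ is Kummerian for every closed subgroup $H$ of $G$. *)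

(* Defs.v *)
From HB Require Import structures.
From mathcomp Require Import all_boot all_algebra all_classical topology.

Set Implicit Arguments.
Unset Strict Implicit.
Unset Printing Implicit Defensive.

Import GRing.Theory.

Local Open Scope classical_set_scope.

HB.mixin Record isTopologicalGroup G & Topological G & Group G := {
  mulg_continuous : continuous (fun xy : G * G => (xy.1 * xy.2)%g) ;
  invg_continuous : continuous (fun x : G => (x^-1)%g)
}.

#[short(type="topologicalGroupType")]
HB.structure Definition TopologicalGroup :=
  {G of Topological G & Group G & isTopologicalGroup G}.

Section Subgroups.
Local Open Scope group_scope.
Context {G : topologicalGroupType}.
Implicit Types A N R : set G.

Definition is_subgroup A :=
  [/\ A 1, forall x y, A x -> A y -> A (x * y) & forall x, A x -> A x^-1].

Definition is_normal_subgroup N :=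
  is_subgroup N /\ forall x g, N x -> N (x ^ g).

Definition left_cosets N : set (set G) :=
  range (fun g => [set g * x | x in N]).

Definition closed_normal_closure R : set G :=
  \bigcap_(N in [set N | [/\ closed N, is_normal_subgroup N & R `<=` N]]) N.

End Subgroups.

Definition continuous_hom {G H : topologicalGroupType} (f : G -> H) :=
  continuous f /\ {morph f : x y / (x * y)%g}.

Record closedSubgroup (G : topologicalGroupType) := ClosedSubgroup {
  subgroup_set :> set G ;
  subgroup_set_subgroup : is_subgroup subgroup_set ;
  subgroup_set_closed : closed subgroup_set
}.

(* A closed subgroup as a topological group in its own right, with the topology
   that set_type carries, i.e. the subspace topology. *)
Definition subgroup_type (G : topologicalGroupType) (H : closedSubgroup G) :
  Type := set_type H.

Definition subgroup_incl (G : topologicalGroupType) (H : closedSubgroup G) :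
  subgroup_type H -> G := val.

Section SubgroupType.
Local Open Scope group_scope.
Variables (G : topologicalGroupType) (H : closedSubgroup G).

Lemma subgroup_group_closed : group_closed [in subgroup_set H].
Proof.
case: (subgroup_set_subgroup H) => H1 HM HV.
split; first by rewrite !inE.
by move=> x y; rewrite !inE => Hx Hy; apply: HM => //; exact: HV.
Qed.

HB.instance Definition _ := SubChoice.copy (subgroup_type H) (set_type H).
HB.instance Definition _ := SubChoice_isSubGroup.Build
  G [in subgroup_set H] (subgroup_type H) subgroup_group_closed.
HB.instance Definition _ :=
  Topological.copy (subgroup_type H) (set_type H).

Lemma subgroup_incl_continuous : continuous (@subgroup_incl G H).
Proof. exact: initial_continuous. Qed.

Lemma subgroup_mulg_continuous :
  continuous (fun xy : subgroup_type H * subgroup_type H => xy.1 * xy.2).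
Proof.
apply/continuous_comp_initial => -[x y].
apply: (@continuous_comp _ _ _ (fun xy : subgroup_type H * subgroup_type H =>
  (subgroup_incl xy.1, subgroup_incl xy.2)) (fun xy : G * G => xy.1 * xy.2)).
  apply: cvg_pair => /=.
    exact: (@continuous_comp _ _ _ fst (@subgroup_incl G H) (x, y) cvg_fst
      (@subgroup_incl_continuous x)).
  exact: (@continuous_comp _ _ _ snd (@subgroup_incl G H) (x, y) cvg_snd
    (@subgroup_incl_continuous y)).
exact: mulg_continuous.
Qed.

Lemma subgroup_invg_continuous :
  continuous (fun x : subgroup_type H => x^-1).
Proof.
apply/continuous_comp_initial => x.
apply: (@continuous_comp _ _ _ (@subgroup_incl G H) (fun x : G => x^-1)).
  exact: subgroup_incl_continuous.
exact: invg_continuous.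
Qed.

HB.instance Definition _ := isTopologicalGroup.Build (subgroup_type H)
  subgroup_mulg_continuous subgroup_invg_continuous.

End SubgroupType.

Definition is_profinite (G : topologicalGroupType) :=
  [/\ compact [set: G], hausdorff_space G & totally_disconnected [set: G]].

Definition is_pro_p (p : nat) (G : topologicalGroupType) :=
  is_profinite G /\
  forall N : set G, open N -> is_normal_subgroup N ->
    exists k, (left_cosets N #= `I_(p ^ k))%card.

(* The index type is finite, so no convergence condition is imposed on y. *)
Definition is_free_pro_p (p : nat) (I : finType) (F : topologicalGroupType)
    (x : I -> F) :=
  is_pro_p p F /\
  forall (H : topologicalGroupType) (y : I -> H), is_pro_p p H ->
    exists! f : F -> H, continuous_hom f /\ forall i, f (x i) = y i.

(* G = < x | R > : G is the quotient of F, free pro-p on x, by the closed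
   normal subgroup generated by R.  A continuous surjection from the compact
   group F onto the Hausdorff group G is a quotient map, so the topology of G
   need not be mentioned separately. *)
Definition pro_p_presentation (p : nat) (I : finType)
    (F : topologicalGroupType) (x : I -> F) (R : set F)
    (G : topologicalGroupType) :=
  [/\ is_free_pro_p p x, is_pro_p p G &
    exists pi : F -> G, [/\ continuous_hom pi, set_surj setT setT pi &
      pi @^-1` [set 1%g] = closed_normal_closure R]].

(* The generators x_1, ..., x_5 are x 0, ..., x 4; MathComp's [~ x, y] is
   x^-1 * y^-1 * x * y. *)
Definition minac_tan_relator (F : topologicalGroupType) (x : 'I_5 -> F) : F :=
  ([~ [~ x (inord 0), x (inord 1)], x (inord 2)] *
   [~ x (inord 3), x (inord 4)])%g.

Definition is_minac_tan (p : nat) (G : topologicalGroupType) :=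
  exists (F : topologicalGroupType) (x : 'I_5 -> F),
    pro_p_presentation p x [set minac_tan_relator x] G.

Local Open Scope ring_scope.

(* The natural map Z/m -> Z/n when n divides m. *)
Definition Zreduce (m n : nat) (x : 'Z_m) : 'Z_n := (x : nat)%:R.

Section Zreduce.
Variables m n : nat.
Hypothesis dvd_nm : ((Zp_trunc n).+2 %| (Zp_trunc m).+2)%N.

Let natr_modm k : (k %% (Zp_trunc m).+2)%:R = k%:R :> 'Z_n.
Proof. by rewrite !Zp_nat; apply/val_inj; rewrite /= modn_dvdm. Qed.

Lemma Zreduce1 : Zreduce n (1 : 'Z_m) = 1.
Proof. by rewrite /Zreduce [LHS]natr_modm. Qed.

Lemma ZreduceD : {morph @Zreduce m n : x y / x + y}.
Proof. by move=> x y; rewrite /Zreduce [LHS]natr_modm natrD. Qed.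

Lemma ZreduceM : {morph @Zreduce m n : x y / x * y}.
Proof. by move=> x y; rewrite /Zreduce [LHS]natr_modm natrM. Qed.

Lemma ZreduceN : {morph @Zreduce m n : x / - x}.
Proof.
move=> x; apply/eqP; rewrite -addr_eq0 -ZreduceD addNr.
by rewrite /Zreduce.
Qed.

End Zreduce.

Lemma dvdn_Zp_trunc (p n : nat) :
  ((Zp_trunc (p ^ n.+1)).+2 %| (Zp_trunc (p ^ n.+2)).+2)%N.
Proof.
case: p => [|[|p]]; [by rewrite !exp0n|by rewrite !exp1n|].
have gt1 k : (1 < p.+2 ^ k.+1)%N by exact: leq_ltn_trans (ltn_expl k.+1 _).
by rewrite !Zp_cast// dvdn_exp2l.
Qed.

(* Z_p as the inverse limit of the rings Z/p^(n+1), n >= 0 (starting at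
   exponent 1 because 'Z_(p ^ 0) is Z/2). *)
Definition padic_seq (p : nat) : Type := forall n, 'Z_(p ^ n.+1)%N.

Section PadicSeq.
Variable p : nat.
Implicit Types a b c : padic_seq p.

HB.instance Definition _ :=
  Choice.copy (padic_seq p) (forall n, 'Z_(p ^ n.+1)%N).

Definition padic_seq_add a b : padic_seq p := fun n => a n + b n.
Definition padic_seq_opp a : padic_seq p := fun n => - a n.
Definition padic_seq_mul a b : padic_seq p := fun n => a n * b n.

Lemma padic_seq_addA : associative padic_seq_add.
Proof. by move=> a b c; apply: functional_extensionality_dep => n; exact: addrA. Qed.
Lemma padic_seq_addC : commutative padic_seq_add.
Proof. by move=> a b; apply: functional_extensionality_dep => n; exact: addrC. Qed.
Lemma padic_seq_add0 : left_id (fun=> 0) padic_seq_add.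
Proof. by move=> a; apply: functional_extensionality_dep => n; exact: add0r. Qed.
Lemma padic_seq_addN : left_inverse (fun=> 0) padic_seq_opp padic_seq_add.
Proof. by move=> a; apply: functional_extensionality_dep => n; exact: addNr. Qed.

HB.instance Definition _ := GRing.isZmodule.Build (padic_seq p)
  padic_seq_addA padic_seq_addC padic_seq_add0 padic_seq_addN.

Lemma padic_seq_mulA : associative padic_seq_mul.
Proof. by move=> a b c; apply: functional_extensionality_dep => n; exact: mulrA. Qed.
Lemma padic_seq_mulC : commutative padic_seq_mul.
Proof. by move=> a b; apply: functional_extensionality_dep => n; exact: mulrC. Qed.
Lemma padic_seq_mul1 : left_id (fun=> 1) padic_seq_mul.
Proof. by move=> a; apply: functional_extensionality_dep => n; exact: mul1r. Qed.
Lemma padic_seq_mulDl : left_distributive padic_seq_mul padic_seq_add.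
Proof. by move=> a b c; apply: functional_extensionality_dep => n; exact: mulrDl. Qed.
Lemma padic_seq_1neq0 : ((fun=> 1) : padic_seq p) != 0.
Proof. by apply/eqP => /(congr1 (fun a : padic_seq p => a 0%N)). Qed.

HB.instance Definition _ := GRing.Zmodule_isComNzRing.Build (padic_seq p)
  padic_seq_mulA padic_seq_mulC padic_seq_mul1 padic_seq_mulDl padic_seq_1neq0.

Definition padic_compatible : set (padic_seq p) :=
  [set a | forall n, Zreduce (p ^ n.+1)%N (a n.+1) = a n].

Lemma padic_subring_closed : GRing.subring_closed [in padic_compatible].
Proof.
split=> [|a b|a b]; rewrite !inE => /=.
- by move=> n; exact/Zreduce1/dvdn_Zp_trunc.
- move=> ca cb n; rewrite -[RHS]/(a n - b n) -ca -cb.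
  rewrite -(ZreduceN (dvdn_Zp_trunc p n)).
  exact: (ZreduceD (dvdn_Zp_trunc p n)).
- move=> ca cb n; rewrite -[RHS]/(a n * b n) -ca -cb.
  exact: (ZreduceM (dvdn_Zp_trunc p n)).
Qed.

End PadicSeq.

Definition padic (p : nat) : Type := set_type (@padic_compatible p).

HB.instance Definition _ (p : nat) :=
  SubChoice.copy (padic p) (set_type (@padic_compatible p)).
HB.instance Definition _ (p : nat) := GRing.SubChoice_isSubComNzRing.Build
  (padic_seq p) [in @padic_compatible p] (padic p) (@padic_subring_closed p).

(* The projection Z_p -> Z_p / p^(n+1) Z_p = Z/p^(n+1). *)
Definition padic_proj (p n : nat) (a : padic p) : 'Z_(p ^ n.+1)%N :=
  (val a : padic_seq p) n.

(* The inverse limit topology. *)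
Definition padic_to_prod (p : nat) (a : padic p) :
    prod_topology (fun n => discrete_topology 'Z_(p ^ n.+1)%N) :=
  fun n => padic_proj n a.

HB.instance Definition _ (p : nat) :=
  Topological.copy (padic p) (initial_topology (@padic_to_prod p)).

Section PadicProj.
Variables p n : nat.

Lemma padic_proj_is_zmod_morphism : zmod_morphism (@padic_proj p n).
Proof. by []. Qed.
HB.instance Definition _ := GRing.isZmodMorphism.Build (padic p) _
  (@padic_proj p n) padic_proj_is_zmod_morphism.

Lemma padic_proj_is_monoid_morphism : monoid_morphism (@padic_proj p n).
Proof. by []. Qed.
HB.instance Definition _ := GRing.isMonoidMorphism.Build (padic p) _
  (@padic_proj p n) padic_proj_is_monoid_morphism.

Lemma padic_proj_surj : set_surj setT setT (@padic_proj p n).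
Proof. by move=> v _; exists (v : nat)%:R => //; rewrite rmorph_nat natr_Zp. Qed.

End PadicProj.

Lemma padic_projP (p : nat) (a b : padic p) :
  (forall n, padic_proj n a = padic_proj n b) -> a = b.
Proof. by move=> ab; apply/val_inj/functional_extensionality_dep. Qed.

Lemma padic_proj_mod (p : nat) (a : padic p) (n m : nat) : (1 < p)%N ->
  padic_proj (n + m) a = padic_proj n a %[mod p ^ n.+1].
Proof.
move=> p1; have gt1 k : (1 < p ^ k.+1)%N.
  by rewrite -[1%N](expn0 p) ltn_exp2l.
elim: m => [|m IHm]; first by rewrite addn0.
rewrite -{}IHm addnS.
have <- : Zreduce (p ^ (n + m).+1)%N (padic_proj (n + m).+1 a) =
    padic_proj (n + m) a.
  by have := valP a; rewrite inE; exact.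
rewrite /Zreduce.
by rewrite val_Zp_nat// modn_dvdm// dvdn_exp2l// ltnS leq_addr.
Qed.

Lemma padic_proj_eq0 (p n : nat) (a : padic p) : (1 < p)%N ->
  padic_proj n a = 0 <-> exists b : padic p, a = p%:R ^+ n.+1 * b.
Proof.
move=> p1; have gt1 k : (1 < p ^ k.+1)%N.
  by rewrite -[1%N](expn0 p) ltn_exp2l.
have p0 k : (0 < p ^ k)%N by rewrite expn_gt0 ltnW.
split=> [a0|[b ->]]; last first.
  by rewrite rmorphM rmorphXn rmorph_nat -natrX pchar_Zp ?mul0r.
pose q k := ((padic_proj (k + n.+1) a : nat) %/ p ^ n.+1)%N.
have qE k : (q k * p ^ n.+1)%N = padic_proj (k + n.+1) a.
  apply: divnK; have := padic_proj_mod a n k.+1 p1.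
  by rewrite a0 [(n + _)%N]addnC addSnnS /= mod0n => /eqP.
pose b : padic_seq p := fun k => (q k)%:R.
have bP : b \in @padic_compatible p.
  rewrite inE => k; rewrite /Zreduce /b val_Zp_nat//.
  rewrite -(Zp_nat_mod (gt1 k)) -[RHS](Zp_nat_mod (gt1 k)); congr (_%:R).
  rewrite modn_dvdm ?dvdn_exp2l//; apply/eqP.
  rewrite -(eqn_pmul2r (p0 n.+1)) !muln_modl !qE -expnD; apply/eqP.
  have := padic_proj_mod a (k + n.+1) 1 p1.
  by rewrite addn1; exact.
pose b' : padic p := Sub b bP; exists b'; apply: padic_projP => k.
rewrite rmorphM rmorphXn rmorph_nat -natrX /=.
have -> : padic_proj k b' = (q k)%:R by rewrite /padic_proj SubK.
rewrite -natrM mulnC qE -[LHS]natr_Zp -[LHS](Zp_nat_mod (gt1 k)).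
by rewrite -(padic_proj_mod a k n.+1 p1) Zp_nat_mod.
Qed.

Definition principal_units (p : nat) : set (padic p) :=
  range (fun l => 1 + p%:R * l).

Definition is_orientation (p : nat) (G : topologicalGroupType)
    (theta : G -> padic p) :=
  [/\ continuous theta, {morph theta : g h / (g * h)%g >-> g * h} &
    forall g, principal_units (theta g)].

(* Continuous cohomology in degree 1 of a discrete G-module M, with G acting on
   M through act. *)
Section Cohomology.
Variables (G : topologicalGroupType) (M : zmodType) (act : G -> M -> M).

Definition cocycles1 : set (G -> M) :=
  [set c | continuous (c : G -> discrete_topology M) /\
           forall g h, c (g * h)%g = c g + act g (c h)].

Definition coboundaries1 : set (G -> M) :=
  range (fun m => fun g => act g m - m).

Definition cohomology_class (c : G -> M) : set (G -> M) :=
  [set (c \+ b) | b in coboundaries1].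

Definition H1 : set (set (G -> M)) := [set cohomology_class c | c in cocycles1].

End Cohomology.

(* The map H^1(G, M) -> H^1(G, N), [c] |-> [f \o c], induced by a morphism
   f : M -> N of G-modules; the union over representatives is a single class. *)
Definition H1_map (G : topologicalGroupType) (M N : zmodType)
    (actN : G -> N -> N) (f : M -> N) (C : set (G -> M)) : set (G -> N) :=
  \bigcup_(c in C) cohomology_class actN (f \o c).

Section Kummerian.
Variables (p : nat) (G : topologicalGroupType) (theta : G -> padic p).

(* The action of G on Z_p(theta) / p^(n+1) Z_p(theta), realized on Z/p^(n+1)
   through padic_proj (see padic_proj_surj and padic_proj_eq0). *)
Definition twisted_act (n : nat) (g : G) (v : 'Z_(p ^ n.+1)%N) :=
  padic_proj n (theta g) * v.

Lemma padic_proj_twisted (n : nat) (g : G) (l : padic p) :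
  padic_proj n (theta g * l) = twisted_act g (padic_proj n l).
Proof. by rewrite rmorphM. Qed.

Definition trivial_act (g : G) (v : 'Z_p) := v.

(* The exponent of p is n.+1, so that n ranges over all of nat. *)
Definition is_kummerian :=
  forall n : nat,
    set_surj (H1 (@twisted_act n)) (H1 trivial_act)
      (H1_map trivial_act (@Zreduce (p ^ n.+1) p)).

End Kummerian.

Definition is_one_cyclotomic (p : nat) (G : topologicalGroupType)
    (theta : G -> padic p) :=
  forall H : closedSubgroup G, is_kummerian (theta \o @subgroup_incl G H).

(* Main.v *)
Require Import Defs.
From HB Require Import structures.
From mathcomp Require Import all_boot all_algebra all_fingroup all_solvable.
From mathcomp Require Import all_classical topology.
From mathcomp Require Import ring.

(** Write [r = [[x_1, x_2], x_3] [x_4, x_5]] for the relator, and let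
    [phi] be the morphism from [G] to the Heisenberg group over [Z/p] that sends
    [x_1] and [x_3] to [X], sends [x_2] to [Y] and kills [x_4] and [x_5].  It
    exists because [[X, Y]] is central ([minac_tan_generators]).  The open
    normal subgroup [N] formed by the elements whose image has first coordinate
    zero carries the character [chi : N -> Z/p] that reads the central coordinate
    of the image.  Whatever the orientation [theta] is, [chi] does not lift to a
    cocycle modulo [p^2], so that [(N, theta)] is not Kummerian.

    For the trivial orientation this is a statement on torsion.  Let
    [a_j = x_2^(x_1^j)] and [w_j = [x_1, x_2]^(x_1^j) = a_{j+1}^-1 a_j].  Modulo
    commutators of [N], conjugating [r] by [x_1^j] yields [w_{j+1} = w_j],
    because [x_1^-1 x_3], [x_4] and [x_5] lie in [N], while
    [w_0 w_1 ... w_{p-1} = a_p^-1 a_0 = 1], because [x_1^p] lies in [N].  Hence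
    [w_0^p] is a product of commutators and every morphism [N -> Z/p^2] sends
    [w_0] into [p Z/p^2], whereas [chi w_0 = 1].

    A general orientation is [theta = 1 + p l] modulo [p^2], and a cocycle [c]
    satisfies [c (g h) = c g + c h + l g * (p c h)], where [p c h] depends only
    on [chi h].  So each error term that [theta] introduces is controlled by
    [chi]: the terms vanish on [[x_4, x_5]] and on [x_1^p], where [chi] does, and
    the recurrence becomes [c w_{j+1} = c w_j + d] with a constant [d] in
    [p Z/p^2].  Summing over [j < p] contributes [d p (p - 1) / 2], which is zero
    modulo [p^2] since [p] is odd, and the contradiction [p = 0] in [Z/p^2]
    remains ([relation_obstructs_cocycle]). *)

Set Implicit Arguments.
Unset Strict Implicit.
Unset Printing Implicit Defensive.

Import GRing.Theory.

Local Open Scope classical_set_scope.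

(** * Finite p-groups as pro-p groups *)

Lemma card_finpred (T : finType) (A : {pred T}) : ([set` A] #= `I_#|A|)%card.
Proof.
have [A0|/card_gt0P[x0 _]] := posnP #|A|.
  rewrite A0 II0.
  rewrite card_eq0; apply/eqP.
  by apply/seteqP; split=> // x /=; rewrite (card0_eq A0).
have -> : [set` A] = (nth x0 (enum A)) @` `I_#|A|.
  apply/seteqP; split=> [x /= xA|_ [i /= iA <-]].
    exists (index x (enum A)); last by rewrite nth_index ?mem_enum.
    by rewrite /= cardE index_mem mem_enum.
  by rewrite -mem_enum mem_nth -?cardE.
apply: inj_card_eq => i j; rewrite !inE /= => iA jA /eqP.
by rewrite nth_uniq -?cardE ?enum_uniq // => /eqP.
Qed.

Definition discrete_group (gT : finGroupType) : Type := discrete_topology gT.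

HB.instance Definition _ (gT : finGroupType) :=
  Group.copy (discrete_group gT) gT.
HB.instance Definition _ (gT : finGroupType) :=
  DiscreteTopology.copy (discrete_group gT) (discrete_topology gT).

Section DiscreteGroup.
Local Open Scope group_scope.
Variable gT : finGroupType.

Lemma discrete_mulg_continuous :
  continuous (fun xy : discrete_group gT * discrete_group gT => xy.1 * xy.2).
Proof.
case=> x y; apply/discrete_cvg => /=.
exists ([set x], [set y]); first by split; exact: discrete_set1.
by case=> a b [/= -> ->].
Qed.

Lemma discrete_invg_continuous :
  continuous (fun x : discrete_group gT => x^-1).
Proof.
move=> x; apply/discrete_cvg.
by apply: (@filterS _ (nbhs x) _ [set x]); [move=> y -> | exact: discrete_set1].
Qed.

HB.instance Definition _ := isTopologicalGroup.Build (discrete_group gT)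
  discrete_mulg_continuous discrete_invg_continuous.

Lemma discrete_group_profinite : is_profinite (discrete_group gT).
Proof.
split.
- exact: (@finite_compact (discrete_group gT) setT (@finite_finset gT setT)).
- exact: discrete_hausdorff.
- exact/zero_dimension_totally_disconnected/discrete_zero_dimension.
Qed.

Lemma discrete_group_pro_p (p : nat) :
  prime p -> p.-group [set: gT]%SET -> is_pro_p p (discrete_group gT).
Proof.
move=> p_pr pG; split; first exact: discrete_group_profinite.
move=> N _ [[N1 NM NV] _].
pose N0 : {set gT} := [set x : gT | `[< N x >]]%SET.
have N0P (x : gT) : (x \in N0) = `[< N x >] by rewrite inE.
have gN0 : group_set N0.
  apply/group_setP; split; first by rewrite N0P; apply/asboolP.
  by move=> x y; rewrite !N0P => /asboolP Nx /asboolP Ny; apply/asboolP/NM.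
pose NG := Group gN0.
have /p_natP[k idxE] : p.-nat #|[set: gT]%SET : NG|.
  by apply: pnat_dvd pG; rewrite dvdn_indexg.
exists k; rewrite -idxE -card_lcosets.
pose L := lcosets NG [set: gT]%SET.
pose toset (A : {set gT}) : set (discrete_group gT) := [set` A].
have -> : left_cosets N = toset @` [set` L].
  apply/seteqP; split=> [_ [g _ <-]|_ [A /= /lcosetsP[g _ ->] <-]].
    exists (g *: NG)%g; first by apply/lcosetsP; exists g; rewrite ?inE.
    apply/seteqP; split=> x /=.
      by case/lcosetP => a; rewrite N0P => /asboolP Na ->; exists a.
    by case=> a Na <-; rewrite /toset /= mem_lcoset mulKg N0P; apply/asboolP.
  exists g => //; apply/seteqP; split=> x /=.
    by case=> a Na <-; rewrite /toset /= mem_lcoset mulKg N0P; apply/asboolP.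
  by case/lcosetP => a; rewrite N0P => /asboolP Na ->; exists a.
have toset_inj : injective toset.
  move=> A B AB; apply/setP => x; apply/idP/idP => xA.
    by have : toset A x by []; rewrite AB.
  by have : toset B x by []; rewrite -AB.
rewrite (card_eql (inj_card_eq _)); last by move=> ? ? _ _; exact: toset_inj.
exact: card_finpred.
Qed.
End DiscreteGroup.

(** * The Heisenberg group over Z/m *)

(** The triple [(x, y, z)] stands for the upper unitriangular matrix with [x] and
    [y] above the diagonal and [z] in the corner. *)
Definition heisenberg (m : nat) : Type := ('Z_m * 'Z_m * 'Z_m)%type.

Section Heisenberg.
Variable m : nat.
Local Open Scope ring_scope.

HB.instance Definition _ :=
  Finite.copy (heisenberg m) ('Z_m * 'Z_m * 'Z_m)%type.

Definition heis (x y z : 'Z_m) : heisenberg m := (x, y, z).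

Definition heis_mul (u v : heisenberg m) : heisenberg m :=
  heis (u.1.1 + v.1.1) (u.1.2 + v.1.2) (u.2 + v.2 + u.1.1 * v.1.2).

Definition heis_inv (u : heisenberg m) : heisenberg m :=
  heis (- u.1.1) (- u.1.2) (u.1.1 * u.1.2 - u.2).

Lemma heis_mulA : associative heis_mul.
Proof.
by case=> -[? ?] ? [[? ?] ?] [[? ?] ?]; congr (_, _, _) => /=; ring.
Qed.

Lemma heis_mul1 : left_id (heis 0 0 0) heis_mul.
Proof. by case=> -[? ?] ?; congr (_, _, _) => /=; ring. Qed.

Lemma heis_mulV : left_inverse (heis 0 0 0) heis_inv heis_mul.
Proof. by case=> -[? ?] ?; congr (_, _, _) => /=; ring. Qed.

HB.instance Definition _ := Finite_isGroup.Build (heisenberg m)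
  heis_mulA heis_mul1 heis_mulV.

Lemma heisM x y z x' y' z' :
  (heis x y z * heis x' y' z')%g = heis (x + x') (y + y') (z + z' + x * y').
Proof. by []. Qed.

Lemma heisV x y z : (heis x y z)^-1%g = heis (- x) (- y) (x * y - z).
Proof. by []. Qed.

Lemma heis_commXY : [~ heis 1%R 0 0, heis 0 1%R 0]%g = heis 0 0 1.
Proof.
by rewrite commgEl conjgE !heisV !heisM; congr (_, _, _) => /=; ring.
Qed.

Lemma heis_central z (u : heisenberg m) : (heis 0 0 z ^ u)%g = heis 0 0 z.
Proof.
case: u => -[a b] c; rewrite -/(heis a b c) conjgE heisV !heisM.
by congr (_, _, _) => /=; ring.
Qed.

Lemma heisX n : (heis 1%R 0 0 ^+ n)%g = heis n%:R 0 0.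
Proof.
elim: n => [|n IHn]; first by rewrite expg0.
by rewrite expgS IHn heisM; congr (_, _, _); ring.
Qed.

Lemma card_heisenberg : (1 < m)%N -> #|{: heisenberg m}| = (m ^ 3)%N.
Proof.
by move=> m1; rewrite !card_prod !card_ord Zp_cast // !expnS expn0 muln1 mulnA.
Qed.

End Heisenberg.

Lemma heisenberg_pro_p (p : nat) :
  prime p -> is_pro_p p (discrete_group (heisenberg p)).
Proof.
move=> p_pr; apply: discrete_group_pro_p => //.
by rewrite /pgroup cardsT card_heisenberg ?prime_gt1 // pnatX pnat_id.
Qed.

(** * Pro-p quotients of the Minac-Tan group *)

Section TopologicalGroups.
Local Open Scope group_scope.

Lemma hom1 (G K : groupType) (f : G -> K) :
  {morph f : x y / x * y} -> f 1 = 1.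
Proof. by move=> fM; apply: (mulgI (f 1)); rewrite -fM !mulg1. Qed.

Lemma homV (G K : groupType) (f : G -> K) :
  {morph f : x y / x * y} -> {morph f : x / x^-1}.
Proof. by move=> fM x; apply: (mulgI (f x)); rewrite -fM !mulgV (hom1 fM). Qed.

Lemma homR (G K : groupType) (f : G -> K) :
  {morph f : x y / x * y} -> {morph f : x y / [~ x, y]}.
Proof. by move=> fM x y; rewrite !fM !(homV fM). Qed.

(** Continuity of the induced map rests on [pi] being closed: its source is
    compact and its target Hausdorff. *)
Lemma factor_through_presentation (F G P : topologicalGroupType)
    (R : set F) (pi : F -> G) (f : F -> P) :
  compact [set: F] -> hausdorff_space G -> hausdorff_space P ->
  continuous_hom pi -> set_surj setT setT pi ->
  pi @^-1` [set 1] = closed_normal_closure R ->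
  continuous_hom f -> (forall r, R r -> f r = 1) ->
  exists2 phi : G -> P, continuous_hom phi & phi \o pi = f.
Proof.
move=> cF hG hP [pic piM] pisurj kerpi [fc fM] fR.
have ker a : pi a = 1 -> f a = 1.
  move=> pia; have : (pi @^-1` [set 1]) a by [].
  rewrite kerpi => /(_ (f @^-1` [set 1])); apply; split.
  - apply: (@closed_comp _ _ f) => [x _|]; first exact: fc.
    exact/accessible_closed_set1/hausdorff_accessible.
  - split; first split=> [|x y|x] /=; first exact: hom1.
    + by move=> fx fy; rewrite fM fx fy mulg1.
    + by move=> fx; rewrite (homV fM) fx invg1.
    + by move=> x g /= fx; rewrite !fM (homV fM) fx mul1g mulVg.
  - by move=> r /fR.
have /choice[s sK] : forall g, exists a, pi a = g.
  by move=> g; have [a _ ag] := pisurj g I; exists a.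
have fs a : f (s (pi a)) = f a.
  apply/eqP; rewrite -divg_eq1 -(homV fM) -fM; apply/eqP/ker.
  by rewrite piM (homV piM) sK mulgV.
exists (f \o s); last by apply/funext => a; exact: fs.
split.
  apply/continuous_closedP => A clA.
  have -> : (f \o s) @^-1` A = pi @` (f @^-1` A).
    apply/seteqP; split=> [g Ag|_ [a Aa <-]]; first by exists (s g).
    by rewrite /preimage /= fs.
  apply: compact_closed => //; apply: continuous_compact.
    exact: continuous_subspaceT.
  apply: subclosed_compact cF _ => //.
  by move/continuous_closedP : fc; exact.
by move=> g h /=; rewrite -{1}(sK g) -{1}(sK h) -piM fs fM.
Qed.

(** The universal property of the presentation, carried over from the free group
    to [G]: the generators may be sent to any elements satisfying the relation. *)
Lemma minac_tan_generators (p : nat) (G : topologicalGroupType) :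
  is_minac_tan p G ->
  exists2 x : 'I_5 -> G, minac_tan_relator x = 1 &
    forall (P : topologicalGroupType) (y : 'I_5 -> P), is_pro_p p P ->
      minac_tan_relator y = 1 ->
      exists2 phi : G -> P, continuous_hom phi & forall i, phi (x i) = y i.
Proof.
move=> [F [x [[[[cF _ _] _] univ] [[_ hG _] _] [pi [pih pisurj kerpi]]]]].
have mtM (K K' : topologicalGroupType) (f : K -> K') (u : 'I_5 -> K) :
    {morph f : x y / x * y} ->
    f (minac_tan_relator u) = minac_tan_relator (f \o u).
  by move=> fM; rewrite /minac_tan_relator fM !(homR fM).
exists (pi \o x).
  rewrite -mtM; last exact: pih.2.
  suff : (pi @^-1` [set 1]) (minac_tan_relator x) by [].
  by rewrite kerpi => N /= [_ _]; apply.
move=> P y pP ry; have [[_ hP _] _] := pP.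
have [f [[fh fx] _]] := univ P y pP.
have [|phi phih phif] :=
    factor_through_presentation cF hG hP pih pisurj kerpi fh.
  move=> _ ->; rewrite mtM; last exact: fh.2.
  by rewrite (_ : f \o x = y) //; apply/funext.
by exists phi => // i; rewrite -fx -phif.
Qed.
End TopologicalGroups.

(** * Lifting characters to twisted cocycles *)

(** The action on [Z/p] is trivial, so its coboundaries vanish and a class in
    [H^1(G, Z/p)] is a single morphism: surjectivity on classes lifts [chi]
    itself, not merely [chi] up to a coboundary. *)
Lemma kummerian_lift (p n : nat) (G : topologicalGroupType)
    (theta : G -> padic p) (chi : G -> 'Z_p) :
  is_kummerian theta ->
  continuous (chi : G -> discrete_topology 'Z_p) ->
  {morph chi : g h / (g * h)%g >-> (g + h)%R} ->
  exists2 c : G -> 'Z_(p ^ n.+1)%N,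
    forall g h, c (g * h)%g = (c g + padic_proj n (theta g) * c h)%R &
    forall g, Zreduce p (c g) = chi g.
Proof.
move=> kum chic chiM.
have trivial_coboundary (b : G -> 'Z_p) :
    coboundaries1 (@trivial_act p G) b -> b = (fun=> 0%R).
  by case=> v _ <-; apply/funext => g; rewrite /trivial_act subrr.
have class_refl (M : zmodType) (act : G -> M -> M) (f : G -> M) :
    (forall g, act g 0%R = 0%R) -> cohomology_class act f f.
  move=> act0; exists (fun g => act g 0%R - 0%R)%R; first by exists 0%R.
  by apply/funext => g /=; rewrite act0 subr0 addr0.
have [|_ [c [cc cM] <-] cE] := kum n (cohomology_class (@trivial_act p G) chi).
  by exists chi.
exists c => // g.
have : H1_map (@trivial_act p G) (@Zreduce (p ^ n.+1) p)
   (cohomology_class (@twisted_act p G theta n) c) (@Zreduce (p ^ n.+1) p \o c).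
  exists c; first by apply: class_refl => h; rewrite /twisted_act mulr0.
  exact: class_refl.
rewrite cE => -[b /trivial_coboundary -> /(congr1 (fun f => f g)) /= <-].
by rewrite addr0.
Qed.

(** The cocycle on [K] is extended to all of [G] by an arbitrary value, so that it
    can be evaluated at elements of [G] without transporting them to the subgroup
    type. *)
Lemma one_cyclotomic_lift (p n : nat) (G : topologicalGroupType)
    (theta : G -> padic p) (K : closedSubgroup G) (chi : G -> 'Z_p) :
  is_one_cyclotomic theta ->
  continuous (chi : G -> discrete_topology 'Z_p) ->
  (forall g h, subgroup_set K g -> subgroup_set K h ->
    chi (g * h)%g = (chi g + chi h)%R) ->
  exists2 c : G -> 'Z_(p ^ n.+1)%N,
    forall g h, subgroup_set K g -> subgroup_set K h ->
      c (g * h)%g = (c g + padic_proj n (theta g) * c h)%R &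
    forall g, subgroup_set K g -> Zreduce p (c g) = chi g.
Proof.
move=> cyc chic chiM.
have KP (h : subgroup_type K) : subgroup_set K (subgroup_incl h).
  by have := valP h; rewrite inE.
have [||c0 c0M c0E] :=
    @kummerian_lift p n _ _ (chi \o @subgroup_incl G K) (cyc K).
- move=> h; apply: (@continuous_comp _ _ _ (@subgroup_incl G K)
    (chi : G -> discrete_topology 'Z_p)); last exact: chic.
  exact: subgroup_incl_continuous.
- by move=> g h /=; apply: chiM; exact: KP.
pose c g := oapp c0 0%R (insub g : option (subgroup_type K)).
have cE (h : subgroup_type K) : c (subgroup_incl h) = c0 h.
  by rewrite /c /subgroup_incl valK.
have KE g : subgroup_set K g -> exists h : subgroup_type K, subgroup_incl h = g.
  by move=> Kg; exists (SigSub (mem_set Kg)).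
exists c => [g h /KE[{}g <-] /KE[{}h <-]|g /KE[{}g <-]].
  by rewrite !cE -c0M -cE.
by rewrite cE c0E.
Qed.

(** Multiplication by [p] on [Z/p^2] factors through [Z/p], so for a lift [c] of
    [chi] the element [p c h] is determined by [chi h]. *)
Lemma mulp_Zreduce (p : nat) (v : 'Z_(p ^ 2)%N) : (1 < p)%N ->
  (p%:R * v = p%:R * (Zreduce p v : nat)%:R)%R.
Proof.
move=> p1; have p21 : (1 < p ^ 2)%N by rewrite (@ltn_exp2l p 0 2).
rewrite /Zreduce val_Zp_nat // -[in LHS](natr_Zp v) {1}(divn_eq v p).
rewrite natrD natrM mulrDr mulrCA -[X in (_ * X + _)%R]natrM mulnn.
by rewrite pchar_Zp // mulr0 add0r.
Qed.

Lemma principal_unit_tangent (p n : nat) (G : topologicalGroupType)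
    (theta : G -> padic p) :
  is_orientation theta -> exists l : G -> 'Z_(p ^ n.+1)%N,
    forall g, (padic_proj n (theta g) = 1 + p%:R * l g)%R.
Proof.
case=> _ _ unit_theta.
have /choice[l lE] : forall g, exists v, (1 + p%:R * v)%R = theta g.
  by move=> g; have [v _ <-] := unit_theta g; exists v.
exists (fun g => padic_proj n (l g)) => g.
by rewrite -lE rmorphD rmorphM rmorph1 rmorph_nat.
Qed.

(** * The relation evaluated on a cocycle modulo p^2 *)

Section Cocycle.
Variables (R : comNzRingType) (p : nat) (G : groupType).
Hypothesis pp0 : (p%:R * p%:R = 0 :> R)%R.
Variables t l : G -> R.
Hypothesis tM : {morph t : g h / (g * h)%g >-> (g * h)%R}.
Hypothesis tE : forall g, (t g = 1 + p%:R * l g)%R.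
Variable H : G -> Prop.
Hypothesis HM : forall g h, H g -> H h -> H (g * h)%g.
Hypothesis HV : forall g, H g -> H (g^-1)%g.
Hypothesis HJ : forall g h, H h -> H (h ^ g)%g.
Variable c : G -> R.
Hypothesis c_cocycle : forall g h, H g -> H h ->
  (c (g * h)%g = c g + t g * c h)%R.

Local Notation b g := (p%:R * c g)%R.
Local Open Scope ring_scope.

Let cM g h : H g -> H h -> c (g * h)%g = c g + (1 + p%:R * l g) * c h.
Proof. by move=> Hg Hh; rewrite c_cocycle // tE. Qed.

(** As [p^2 = 0] in [R], the map [g |-> p l g] is a morphism to an abelian group; in
    particular it is invariant under conjugation. *)
Let lM : {morph (fun g => p%:R * l g) : g h / (g * h)%g >-> g + h}.
Proof.
move=> g h; have := tM g h; rewrite !tE => e.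
transitivity ((1 + p%:R * l (g * h)%g) - 1); first by ring.
rewrite e; transitivity (p%:R * l g + p%:R * l h + p%:R * p%:R * (l g * l h)).
  by ring.
by rewrite pp0; ring.
Qed.

Lemma tangentV g : p%:R * l g^-1%g = - (p%:R * l g).
Proof.
have l1 : p%:R * l 1%g = 0.
  by apply: (addrI (p%:R * l 1%g)); rewrite -lM mulg1 addr0.
by apply/eqP; rewrite -addr_eq0 -lM mulVg l1.
Qed.

Lemma tangentJ g h : p%:R * l (h ^ g)%g = p%:R * l h.
Proof. by rewrite conjgE !lM tangentV; ring. Qed.

Lemma tangentX g n : p%:R * l (g ^+ n)%g = n%:R * (p%:R * l g).
Proof.
elim: n => [|n IHn]; last by rewrite expgS lM IHn; ring.
by rewrite expg0 -(mulVg g) lM tangentV; ring.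
Qed.

(** [p c] plays the part of the character that [c] lifts. *)
Lemma cocycle_charM g h : H g -> H h -> b (g * h)%g = b g + b h.
Proof.
move=> Hg Hh; rewrite cM //.
transitivity (b g + b h + p%:R * p%:R * (l g * c h)); first by ring.
by rewrite pp0; ring.
Qed.

Lemma cocycle1 g : H g -> c 1%g = 0.
Proof.
move=> Hg; have H1 : H 1%g by rewrite -(mulVg g); apply: HM => //; exact: HV.
have b1 : b 1%g = 0.
  by apply: (addrI (b 1%g)); rewrite -cocycle_charM // mulg1 addr0.
have := cM H1 H1; rewrite mulg1.
have -> : (1 + p%:R * l 1%g) * c 1%g = c 1%g + l 1%g * b 1%g by ring.
rewrite b1 mulr0 addr0 => /(congr1 (fun x => x - c 1%g)).
by rewrite subrr addrK.
Qed.

Lemma cocycle_charV g : H g -> b g^-1%g = - b g.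
Proof.
move=> Hg; apply/eqP; rewrite -addr_eq0 -cocycle_charM //; last exact: HV.
by rewrite mulVg (cocycle1 Hg) mulr0.
Qed.

Lemma cocycleV g : H g -> c g^-1%g = - c g + l g * b g.
Proof.
move=> Hg; have := cM Hg (HV Hg); rewrite mulgV (cocycle1 Hg).
have -> : (1 + p%:R * l g) * c g^-1%g = c g^-1%g + l g * b g^-1%g by ring.
rewrite cocycle_charV // => e; apply: (addrI (c g - l g * b g)).
by transitivity (0 : R); [rewrite e; ring | ring].
Qed.

Lemma cocycle_charJ g h : H g -> H h -> b (h ^ g)%g = b h.
Proof.
move=> Hg Hh; have HgV := HV Hg; have Hhg := HM Hh Hg.
by rewrite conjgE !cocycle_charM // cocycle_charV //; ring.
Qed.

(** Since [l] matters only modulo [p] and [p c] is a morphism, the pairing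
    [(g, h) |-> l g * (p c h)] is bilinear, and [c] behaves like a coordinate on a
    nilpotent group of class two: conjugation changes it by the antisymmetrization
    of the pairing. *)
Lemma cocycleJ g h : H g -> H h -> c (h ^ g)%g = c h + l h * b g - l g * b h.
Proof.
move=> Hg Hh; have Hj := HJ g Hh.
have := congr1 c (conjgC h g); rewrite (cM Hh Hg) (cM Hg Hj) => e.
have -> : c (h ^ g)%g = (c g + (1 + p%:R * l g) * c (h ^ g)%g) - c g
   - l g * b (h ^ g)%g by ring.
by rewrite -e cocycle_charJ //; ring.
Qed.

(** Applied to the conjugates of [x4] and [x5], whatever values [t] takes there:
    the pairing vanishes because [p c] does. *)
Lemma cocycleR0 g h : H g -> H h -> b g = 0 -> b h = 0 -> c [~ g, h]%g = 0.
Proof.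
move=> Hg Hh g0 h0; rewrite commgEl cM; [|exact: HV|exact: HJ].
rewrite cocycleV // cocycleJ // g0 h0.
have -> : (1 + p%:R * l g^-1%g) * (c g + l g * 0 - l h * 0) =
    c g + l g^-1%g * b g by ring.
by rewrite g0; ring.
Qed.

Variables x1 x2 x3 x4 x5 : G.
Hypothesis rel : ([~ [~ x1, x2], x3] * [~ x4, x5] = 1)%g.
Hypothesis p_odd : odd p.
Hypotheses (Hx2 : H x2) (Hx4 : H x4) (Hx5 : H x5).
Hypotheses (Hz : H (x1^-1 * x3)%g) (Hp : H (x1 ^+ p)%g).
(* Through [p c] these record the character that c lifts: it vanishes on x1 ^+ p
   and on the conjugates of x4 and x5, and is 1 on those of [~ x1, x2]. *)
Hypothesis bp : b (x1 ^+ p)%g = 0.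
Hypothesis b4 : forall j, b (x4 ^ (x1 ^+ j))%g = 0.
Hypothesis b5 : forall j, b (x5 ^ (x1 ^+ j))%g = 0.
Hypothesis bw : forall j, b ([~ x1, x2] ^ (x1 ^+ j))%g = p%:R.

Let a j := (x2 ^ (x1 ^+ j))%g.
Let w j := ([~ x1, x2] ^ (x1 ^+ j))%g.
Let z := (x1^-1 * x3)%g.

Let Ha j : H (a j). Proof. exact: HJ. Qed.

Let wE j : w j = ((a j.+1)^-1 * a j)%g.
Proof. by rewrite /w /a commgEr conjMg expgS conjgM !conjVg. Qed.

Let Hw j : H (w j).
Proof. by rewrite wE; apply: HM => //; exact: HV. Qed.

Let cw j : c (w j) = c (a j) - c (a j.+1) - p%:R * l x2.
Proof.
have HaV := HV (Ha j.+1); rewrite wE (cM HaV (Ha j)).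
rewrite (cocycleV (Ha _)) tangentV tangentJ.
have -> : l (a j.+1) * b (a j.+1) = (p%:R * l (a j.+1)) * c (a j.+1) by ring.
rewrite tangentJ.
have e : b (a j) - b (a j.+1) = p%:R.
  apply: etrans (bw j); rewrite -/(w j) wE (cocycle_charM HaV (Ha j)).
  by rewrite (cocycle_charV (Ha _)); ring.
transitivity (c (a j) - c (a j.+1) - l x2 * (b (a j) - b (a j.+1))).
  by ring.
by rewrite e; ring.
Qed.

(** This is the relation conjugated by [x1 ^+ j].  As [x3 = x1 * z] with [z] in
    [H], it says that [w j.+1], conjugated inside [H], is [w j] up to a commutator
    on which [c] vanishes. *)
Let cwS j : c (w j.+1) = c (w j) + p%:R * l z.
Proof.
set y := (x1 ^+ j)%g.
have rel_y : (w j.+1 ^ (z ^ y) = w j * [~ x4 ^ y, x5 ^ y]^-1)%g.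
  apply: (mulgI (w j)^-1%g); rewrite mulKg; apply/eqP.
  rewrite -mulg_eq1; apply/eqP.
  have -> : ((w j)^-1 * w j.+1 ^ (z ^ y) = [~ [~ x1, x2], x3] ^ y)%g.
    set k := [~ x1, x2]%g.
    rewrite (conjMg k^-1 (k ^ x3) y) (conjVg k y); congr (_ * _)%g.
    rewrite -(conjgM k x3 y) -[in LHS](conjgM k (x1 ^+ j.+1) (z ^ y)).
    by congr (k ^ _)%g; rewrite expgS -mulgA -conjgC mulgA mulKVg.
  by rewrite -(conjRg x4 x5 y) -conjMg rel conj1g.
have Hk : H [~ x4 ^ y, x5 ^ y]%g.
  by rewrite commgEl; apply: HM; [apply: HV | apply: HJ]; exact: HJ.
have ck : c [~ x4 ^ y, x5 ^ y]%g = 0.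
  by apply: cocycleR0; [exact: HJ | exact: HJ | exact: b4 | exact: b5].
have Hzy : H (z ^ y)%g by exact: HJ.
have := congr1 c rel_y; rewrite (cocycleJ Hzy (Hw _)) (cM (Hw j) (HV Hk)).
rewrite (cocycleV Hk) ck bw.
have -> : l (w j.+1) * b (z ^ y)%g = (p%:R * l (w j.+1)) * c (z ^ y)%g by ring.
have -> : p%:R * l (w j.+1) = 0.
  by rewrite wE lM tangentV !tangentJ; ring.
have <- : p%:R * l (z ^ y)%g = p%:R * l z by exact: tangentJ.
move=> e; transitivity (c (w j.+1) + 0 * c (z ^ y)%g - l (z ^ y)%g * p%:R
    + p%:R * l (z ^ y)%g); first by ring.
by rewrite e; ring.
Qed.

Let cwE j : c (w j) = c (w 0) + j%:R * (p%:R * l z).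
Proof. by elim: j => [|j IHj]; [ring | rewrite cwS IHj; ring]. Qed.

(** Summing [c (a j) - c (a j.+1)] telescopes; the arithmetic progression
    [c (w j)] produces the binomial coefficient. *)
Let sum_cw n :
  c (a 0) - c (a n) =
  n%:R * (c (w 0) + p%:R * l x2) + 'C(n, 2)%:R * (p%:R * l z).
Proof.
elim: n => [|n IHn]; first by rewrite bin0n /=; ring.
transitivity ((c (a 0) - c (a n)) + (c (w n) + p%:R * l x2)).
  by rewrite cw; ring.
by rewrite IHn (cwE n) binS bin1; ring.
Qed.

(** At [n = p] the left side of [sum_cw] vanishes, as [a p] is conjugate to [a 0]
    under [x1 ^+ p]; oddness of [p] makes ['C(p, 2)] a multiple of [p], so that only
    [p c (w 0) = p] survives on the right. *)
Lemma relation_obstructs_cocycle : p%:R = 0 :> R.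
Proof.
have := sum_cw p; have -> : c (a p) = c (a 0).
  rewrite /a expg0 conjg1 cocycleJ // bp.
  have -> : l (x1 ^+ p)%g * b x2 = (p%:R * l (x1 ^+ p)%g) * c x2 by ring.
  by rewrite tangentX mulrA pp0; ring.
rewrite subrr bin2odd //.
have -> : p%:R * (c (w 0) + p%:R * l x2) + (p * p.-1./2)%:R * (p%:R * l z) =
  b (w 0) + (p%:R * p%:R) * (l x2 + p.-1./2%:R * l z) by rewrite natrM; ring.
by rewrite pp0 bw mul0r addr0.
Qed.

End Cocycle.

(** * The Minac-Tan group is never 1-cyclotomic *)

Theorem theorem1p4 (p : nat) (G : topologicalGroupType) :
  prime p -> odd p -> is_minac_tan p G ->
  ~ exists theta : G -> padic p, is_orientation theta /\ is_one_cyclotomic theta.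
Proof.
move=> p_pr p_odd /minac_tan_generators[x rel univ] [theta [or_theta cyc]].
have p1 := prime_gt1 p_pr.
have p21 : (1 < p ^ 2)%N by rewrite (@ltn_exp2l p 0 2).
pose X : heisenberg p := heis 1%R 0%R 0%R.
pose Y : heisenberg p := heis 0%R 1%R 0%R.
(* The default value 1 of nth is the image of x_4 and x_5. *)
pose y (i : 'I_5) : discrete_group (heisenberg p) := nth 1%g [:: X; Y; X] i.
have [||phi [phic phiM] phix] := univ _ y.
- exact: heisenberg_pro_p.
- rewrite /minac_tan_relator /y !inordK //= commg1 mulg1 heis_commXY.
  by apply/eqP/commgP; rewrite /commute !heisM; congr (_, _, _); ring.
have [phi1 phi2 phi3] : [/\ phi (x (inord 0)) = X, phi (x (inord 1)) = Y &
    phi (x (inord 2)) = X] by rewrite !phix /y !inordK.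
have [phi4 phi5] : phi (x (inord 3)) = 1%g /\ phi (x (inord 4)) = 1%g.
  by rewrite !phix /y !inordK.
have closedK (P : set (heisenberg p)) : closed (phi @^-1` P).
  by move/continuous_closedP : phic; apply; exact: discrete_closed.
pose N : set G := [set g | (phi g).1.1 = 0%R].
have KS : is_subgroup N.
  rewrite /N; split=> [|g h|g] /=.
  - by rewrite (hom1 phiM).
  - by rewrite phiM /= => -> ->; rewrite addr0.
  - by rewrite (homV phiM) /= => ->; rewrite oppr0.
pose K := ClosedSubgroup KS (closedK [set u | u.1.1 = 0%R]).
have NJ g h : N h -> N (h ^ g)%g.
  rewrite /N /= conjgE !phiM (homV phiM) /= => ->.
  by rewrite add0r addNr.
have [||c cM cE] :=
    @one_cyclotomic_lift p 1 G theta K (fun g => (phi g).2) cyc.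
- by apply/continuous_closedP => A _; exact: (closedK [set u | A u.2]).
- by move=> g h Kg Kh; rewrite phiM /= (_ : (phi g).1.1 = 0%R) ?mul0r ?addr0.
have [l lE] := principal_unit_tangent 1 or_theta.
have pp0 : (p%:R * p%:R = 0 :> 'Z_(p ^ 2)%N)%R.
  by rewrite -natrM mulnn pchar_Zp.
pose t g := padic_proj 1 (theta g).
have tM : {morph t : g h / (g * h)%g >-> (g * h)%R}.
  by move=> g h; rewrite /t -rmorphM; case: or_theta => _ ->.
have bE g : N g -> (p%:R * c g = p%:R * ((phi g).2 : nat)%:R)%R.
  by move=> Kg; rewrite mulp_Zreduce // cE.
have phiX g n : phi (g ^+ n)%g = (phi g ^+ n)%g.
  by elim: n => [|n IHn]; rewrite ?expg0 ?(hom1 phiM) // !expgS phiM IHn.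
have phiJ g h : phi (g ^ h)%g = (phi g ^ phi h)%g.
  by rewrite !conjgE !phiM (homV phiM).
have phi_xp : phi (x (inord 0) ^+ p)%g = 1%g.
  by rewrite phiX phi1 heisX pchar_Zp.
have phi_w j : phi ([~ x (inord 0), x (inord 1)] ^ (x (inord 0) ^+ j))%g =
    heis 0%R 0%R 1%R.
  by rewrite phiJ (homR phiM) phi1 phi2 heis_commXY heis_central.
have b0 g : phi g = 1%g -> (p%:R * c g = 0)%R.
  by move=> g1; rewrite bE /N /= ?g1 // mulr0.
have [_ HM HV] := KS.
suff /(congr1 (@nat_of_ord _)) : (p%:R = 0 :> 'Z_(p ^ 2)%N)%R.
  rewrite val_Zp_nat // modn_small => [p_eq0|].
    by rewrite p_eq0 in p1.
  by rewrite -[X in (X < _)%N]expn1 ltn_exp2l.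
apply: (@relation_obstructs_cocycle _ p G pp0 t l tM lE N HM HV NJ c cM
  _ _ _ _ _ rel p_odd) => [||||||j|j|j].
- by rewrite /N /= phi2.
- by rewrite /N /= phi4.
- by rewrite /N /= phi5.
- by rewrite /N /= phiM (homV phiM) phi1 phi3 mulVg.
- by rewrite /N /= phi_xp.
- exact: b0.
- by apply: b0; rewrite phiJ phi4 conj1g.
- by apply: b0; rewrite phiJ phi5 conj1g.
- by rewrite bE /N /= phi_w // mulr1.
Qed.
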